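(* Let $A, B \in \mathbb{N}$ and let $p > 3$ be a prime. For integers $n \geq 0$ define $$C(n, A, B) := \sum_{k=0}^{n} \binom{n}{k}^{A} \binom{2k}{k}^{B}.$$ Then for any $m, r \in \mathbb{N}$ we have $$C(mp^r, A, B) \equiv C(mp^{r-1}, A, B) \pmod{p^{3r}}$$ if $A \geq 3$, and $$C(mp^r, 2, B) \equiv C(mp^{r-1}, 2, B) \pmod{p^{2r}}.$$
   Context: $\mathbb{N}$ denotes the natural numbers as in the paper; in particular $r \geq 1$. *)

(* Defs.v *)
From mathcomp Require Import all_boot.

Set Implicit Arguments.
Unset Strict Implicit.
Unset Printing Implicit Defensive.

Definition Csum (n A B : nat) : nat :=
  \sum_(k < n.+1) 'C(n, k) ^ A * 'C(2 * k, k) ^ B.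

(* Main.v *)
Require Import Defs.
From mathcomp Require Import all_boot all_algebra zify ring.

(** Write [n = m * p ^ (r - 1)].  In [Csum (p * n)] the terms with [k] prime to
    [p] vanish modulo [p ^ (A * r)], because [p ^ r] divides ['C(p * n, k)].
    The others, [k = p * j], are compared with the terms of [Csum n].  If
    [p ^ t] divides [p * b] and [p * c], then ['C(p * (c + b), p * b)] is
    ['C(c + b, b)] times a [p]-adic unit [N / D], where [N] and [D] are the
    products of [p * c + i] and of [i] over the [i < p * b] prime to [p].
    Pairing [i] with [p * b - i] gives [N ^ 2 = D ^ 2] modulo [p ^ (3 * t)], since
    the sum of the [1 / i ^ 2] vanishes modulo [p ^ t] for [p > 3]; hence
    [N = D].  The power of [p] which is missing when [j] has a small valuation
    is supplied by the factor ['C(n, j) ^ A]. *)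

Set Implicit Arguments.
Unset Strict Implicit.
Unset Printing Implicit Defensive.

Import GRing.Theory.

(** * Products over indices prime to [p], and factorials *)

Lemma big_nat_dvdn (R : Type) (idx : R) (op : Monoid.law idx) (p n : nat)
    (F : nat -> R) : 0 < p ->
  \big[op/idx]_(0 <= i < p * n | p %| i) F i
    = \big[op/idx]_(0 <= j < n) F (p * j).
Proof.
move=> p_gt0; elim: n => [|n IHn]; first by rewrite muln0 !big_geq.
rewrite (big_cat_nat (n := p * n)) ?leq_mul //= IHn big_nat_recr //=.
congr (op _ _).
rewrite big_ltn_cond; last by rewrite ltn_mul2l p_gt0 /=.
rewrite dvdn_mulr // big_nat_cond big_pred0 ?Monoid.mulm1 // => i.
apply/negP => /andP[/andP[lt_i i_lt] /dvdnP[k def_i]].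
by move: lt_i i_lt; rewrite def_i (mulnC k) !ltn_mul2l p_gt0 /= ltnS ltnNge => /negP.
Qed.

Lemma eqn_mod_coprime_cancel (d D x y : nat) :
  coprime d D -> D * x = D * y %[mod d] -> x = y %[mod d].
Proof.
move=> co_dD; wlog le_yx : x y / y <= x.
  by move=> IH; case: (leqP y x) => [/IH // |/ltnW/IH h /esym/h].
move/eqP; rewrite eqn_mod_dvd ?leq_mul // -mulnBr Gauss_dvdr //.
by rewrite -eqn_mod_dvd // => /eqP.
Qed.

(* [c + i] is prime to [p] under the filter only when [p %| c]. *)
Definition prime_to_prod (p c b : nat) : nat :=
  \prod_(0 <= i < b | ~~ (p %| i)) (c + i).

Lemma prime_to_prod_cat (p c b : nat) : p %| c ->
  prime_to_prod p 0 (c + b) = prime_to_prod p 0 c * prime_to_prod p c b.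
Proof.
move=> p_c; rewrite /prime_to_prod (big_cat_nat (n := c)) ?leq_addr //=.
congr (_ * _); rewrite -{1}(add0n c) big_addn addKn.
by apply: eq_big => [i|i _]; rewrite ?dvdn_addl // add0n addnC.
Qed.

Lemma fact_addn (m k : nat) : (m + k)`! = m`! * \prod_(1 <= i < k.+1) (m + i).
Proof.
elim: k => [|k IHk]; first by rewrite big_geq // addn0 muln1.
by rewrite big_nat_recr //= addnS factS IHk mulnC mulnA.
Qed.

Lemma fact_mul_prime_to_prod (p n : nat) : 0 < p ->
  (p * n)`! = p ^ n * n`! * prime_to_prod p 0 (p * n).
Proof.
move=> p_gt0; elim: n => [|n IHn]; first by rewrite muln0 /prime_to_prod big_geq.
rewrite mulnS addnC fact_addn IHn prime_to_prod_cat ?dvdn_mulr //.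
rewrite big_nat_recr //= [prime_to_prod _ (p * n) p]/prime_to_prod [X in _ = _ * (_ * X)]big_ltn_cond // dvdn0 /=.
have -> : \prod_(1 <= i < p | ~~ (p %| i)) (p * n + i)
    = \prod_(1 <= i < p) (p * n + i).
  rewrite big_nat_cond [RHS]big_nat_cond; apply: eq_bigl => i.
  by rewrite andbT; case: (ltnP 0 i) => //= i_gt0; case: ltnP => // /gtnNdvd ->.
rewrite factS expnS; set P := prime_to_prod _ _ _; set Q := \prod_(_ <= i < _) _.
ring.
Qed.

Lemma prime_to_prod_gt0 (p c b : nat) : 0 < prime_to_prod p c b.
Proof.
rewrite /prime_to_prod big_seq_cond; apply: prodn_cond_gt0 => i.
by case: i => [|i]; rewrite ?dvdn0 ?andbF // addnS.
Qed.

(** Splitting off the multiples of [p] in each factorial leaves the same powers of [p], [c!], [b!]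
    and the product below [p * c] on both sides; these cancel. Cross-multiplied to stay in [nat]. *)
Lemma bin_mul_prime (p c b : nat) : 0 < p ->
  'C(p * c + p * b, p * b) * prime_to_prod p 0 (p * b)
    = 'C(c + b, b) * prime_to_prod p (p * c) (p * b).
Proof.
move=> p_gt0.
have := bin_fact (leq_addl (p * c) (p * b)); rewrite addnK -mulnDr.
rewrite !fact_mul_prime_to_prod // mulnDr prime_to_prod_cat ?dvdn_mulr //.
rewrite -(bin_fact (leq_addl c b)) addnK expnD.
have := prime_to_prod_gt0 p 0 (p * c).
set Pc := prime_to_prod _ _ (p * c); set Pb := prime_to_prod _ 0 _.
set N := prime_to_prod _ _ _ => Pc_gt0 eqF.
have K_gt0 : 0 < p ^ c * p ^ b * c`! * b`! * Pc.
  by rewrite !muln_gt0 !fact_gt0 !expn_gt0 p_gt0 Pc_gt0.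
by apply/eqP; rewrite -(eqn_pmul2l K_gt0); apply/eqP; nia.
Qed.

Lemma coprime_prime_to_prod (p c b : nat) : prime p -> p %| c ->
  coprime p (prime_to_prod p c b).
Proof.
move=> p_pr p_c; rewrite /prime_to_prod.
apply: (big_ind (coprime p)); rewrite ?coprimen1 //.
  by move=> x y px py; rewrite coprimeMr px py.
by move=> i; rewrite prime_coprime // dvdn_addr.
Qed.

(** * First-order expansion and sums of inverse squares *)

Section PowerSums.
Local Open Scope ring_scope.

(** Factoring out each unit [x i] leaves the product of the [1 + e / x i], whose terms of order two
    or more in [e] vanish. *)
Lemma prod_add_sqr0 (R : comUnitRingType) (I : Type) (r : seq I) (P : pred I)
    (x : I -> R) (e : R) :
  e * e = 0 -> (forall i, P i -> x i \is a GRing.unit) ->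
  \prod_(i <- r | P i) (x i + e)
    = \prod_(i <- r | P i) x i * (1 + \sum_(i <- r | P i) e / x i).
Proof.
move=> ee0 Ux; have eS s : e * \sum_(i <- s | P i) e / x i = 0.
  by rewrite big_distrr big1 //= => i _; rewrite mulrA ee0 mul0r.
elim: r => [|i r IHr]; first by rewrite !big_nil addr0 mulr1.
rewrite !big_cons; case: ifP => // Pi; rewrite IHr.
set S := \sum_(_ <- _ | _) _; set T := \prod_(_ <- _ | _) _.
have eS0 : e * S = 0 by exact: eS.
have xV : x i * (e / x i) = e by rewrite mulrCA divrr ?mulr1 ?Ux.
clearbody S T; move: (e / x i) xV => z xV.
transitivity (T * (x i + x i * S + e + e * S)); first by ring.
by rewrite eS0 addr0 -xV; ring.
Qed.

(* The sum is unchanged, up to the factor [1 / 4], by the permutation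
   [i |-> 2 i] of the residues modulo [p ^ t]; hence it is killed by [3]. *)
Lemma sum_inv_sqr_eq0 (R : comUnitRingType) (p t w : nat) (e : R) :
  prime p -> (3 < p)%N -> (0 < t)%N ->
  (forall i, ~~ (p %| i)%N -> (i%:R : R) \is a GRing.unit) ->
  e * (p ^ t)%:R = 0 ->
  \sum_(0 <= i < p ^ t * w | ~~ (p %| i)%N) e / i%:R ^+ 2 = 0.
Proof.
move=> p_pr p_gt3 t_gt0 Up eq0; set q := (p ^ t)%N.
have q_gt0 : (0 < q)%N by rewrite expn_gt0 prime_gt0.
have p_q : (p %| q)%N by rewrite dvdn_exp.
(* Extending by zero at multiples of [p] makes the summand periodic modulo [q]: as [e * q = 0], only
   residues matter. *)
pose f i := if (p %| i)%N then 0 else e / i%:R ^+ 2 : R.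
have e_mod i : e * (i %% q)%:R = e * i%:R.
  by rewrite {2}(divn_eq i q) natrD natrM mulrDr mulrCA eq0 mulr0 add0r.
have f_mod i : f (i %% q)%N = f i.
  rewrite /f; have -> : (p %| i %% q)%N = (p %| i)%N.
    by rewrite {2}(divn_eq i q) dvdn_addr // dvdn_mull.
  case: ifP => // /negbT pi.
  have Ui := Up _ pi; have Uj : ((i %% q)%:R : R) \is a GRing.unit.
    apply: Up; apply: contra pi => h.
    by rewrite (divn_eq i q) dvdn_add // dvdn_mull.
  set j := (i %% q)%:R in Uj *; have ej : e * j = e * i%:R by exact: e_mod.
  apply: (mulIr (unitrX 2 Uj)); rewrite divrK ?unitrX //.
  apply: (mulIr (unitrX 2 Ui)); rewrite mulrAC divrK ?unitrX //.
  apply: (@etrans _ _ ((e * i%:R) * i%:R)); first by ring.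
  by rewrite -ej mulrAC -ej; ring.
have U2 : (2%:R : R) \is a GRing.unit by apply: Up; rewrite gtnNdvd // (ltn_trans _ p_gt3).
have U3 : (3%:R : R) \is a GRing.unit by apply: Up; rewrite gtnNdvd.
have co_q2 : coprime q 2.
  by rewrite coprimeXl // prime_coprime // gtnNdvd // (ltn_trans _ p_gt3).
have f2 i : f i = 2%:R ^+ 2 * f (2 * i)%N.
  have p2 : (p %| 2)%N = false by rewrite gtnNdvd // (ltn_trans _ p_gt3).
  rewrite /f Euclid_dvdM // p2 /=.
  case: ifP => [|/negbT pi]; first by rewrite mulr0.
  have Ui := Up _ pi.
  rewrite natrM exprMn; move: (unitrX 2 Ui) (unitrX 2 U2).
  move: (i%:R ^+ 2) (2%:R ^+ 2) => y z Uy Uz.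
  by rewrite invrM // [RHS]mulrC mulrA divrK.
have sum_block : \sum_(0 <= i < q) f i = 0.
  pose h (i : 'I_q) : 'I_q := Ordinal (ltn_pmod (2 * i) q_gt0).
  have h_inj : injective h.
    move=> i j /(congr1 val) /= /(eqn_mod_coprime_cancel co_q2).
    by rewrite !modn_small // => /val_inj.
  rewrite big_mkord; set S := \sum_(_ < _) _.
  have S4 : S = 2%:R ^+ 2 * S.
    rewrite {2}/S (reindex_inj h_inj) /= mulr_sumr.
    by apply: eq_bigr => i _; rewrite f_mod -f2.
  apply: (mulrI U3); rewrite mulr0.
  have -> : 3%:R * S = 2%:R ^+ 2 * S - S by ring.
  by rewrite -S4 subrr.
rewrite big_mkcond (eq_bigr f) => [|i _]; last by rewrite /f if_neg.
elim: w => [|w IHw]; first by rewrite muln0 big_geq.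
rewrite (big_cat_nat (n := (q * w)%N)) ?leq_mul //= IHw add0r.
rewrite -{1}(add0n (q * w)%N) big_addn -mulnBr subSnn muln1.
rewrite -[RHS]sum_block; apply: eq_bigr => i _.
by rewrite -f_mod addnC mulnC modnMDl f_mod.
Qed.

End PowerSums.

(** * The congruence between the two products *)

(** The factors at [i] and [b - i] multiply to [(c + i) * (c + b - i) = i * (b - i) + c * (c +
    b)]. *)
Lemma sqr_prime_to_prod (p c b : nat) : p %| b ->
  prime_to_prod p c b ^ 2
    = \prod_(0 <= i < b | ~~ (p %| i)) (i * (b - i) + c * (c + b)).
Proof.
rewrite /prime_to_prod; case: b => [|b] p_b; first by rewrite !big_geq.
(* Index 0 is filtered out; dropping it leaves a range that [i |-> b - i] maps to itself. *)
rewrite [X in X ^ 2]big_ltn_cond // [RHS]big_ltn_cond // dvdn0 /= -mulnn.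
rewrite [X in _ * X = _]big_nat_rev /=.
have -> : \prod_(1 <= i < b.+1 | ~~ (p %| 1 + b.+1 - i.+1)) (c + (1 + b.+1 - i.+1))
   = \prod_(1 <= i < b.+1 | ~~ (p %| i)) (c + (b.+1 - i)).
  rewrite big_nat_cond [RHS]big_nat_cond; apply: eq_big => [i|i _].
    case: (boolP (0 < i < b.+1)) => //= /andP[_ i_lt]; rewrite add1n subSS.
    by rewrite (dvdn_subr (ltnW i_lt) p_b).
  by rewrite add1n subSS.
rewrite -big_split big_nat_cond [RHS]big_nat_cond; apply: eq_bigr => i.
case/andP=> /andP[_ /ltnW i_le] _ /=; move: (subnK i_le) => <-.
rewrite addnK; ring.
Qed.

Lemma prime_to_prod_mod (p t c b : nat) : prime p -> 3 < p -> 0 < t ->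
  p ^ t %| c -> p ^ t %| b ->
  prime_to_prod p c b = prime_to_prod p 0 b %[mod p ^ (3 * t)].
Proof.
move=> p_pr p_gt3 t_gt0 q_c q_b.
have p_gt1 := prime_gt1 p_pr.
have p_q : p %| p ^ t by rewrite dvdn_exp.
have [p_c p_b] := (dvdn_trans p_q q_c, dvdn_trans p_q q_b).
set M := p ^ (3 * t).
have M_gt1 : 1 < M by rewrite -(exp1n (3 * t)) ltn_exp2r // muln_gt0.
have def_M : M = p ^ t * p ^ t * p ^ t.
  by rewrite /M mulnC expnM !expnS expn0 muln1 mulnA.
have M_0 k : M %| k -> (k%:R = 0 :> 'Z_M)%R.
  by case/dvdnP=> w ->; rewrite natrM pchar_Zp // mulr0.
have M_unit k : coprime p k -> (k%:R : 'Z_M)%R \is a GRing.unit.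
  by move=> co; rewrite unitZpE // coprimeXl.
have Up i : ~~ (p %| i) -> (i%:R : 'Z_M)%R \is a GRing.unit.
  by move=> pi; rewrite M_unit // prime_coprime.
set N := prime_to_prod p c b; set D := prime_to_prod p 0 b.
have N_mod_p : N = D %[mod p].
  apply: (big_ind2 (fun x y => x = y %[mod p])) => // [x y z w xy zw|i _].
    by rewrite -modnMm xy zw modnMm.
  by rewrite -modnDml (eqP p_c).
have eqND2 : ((N ^ 2)%:R = (D ^ 2)%:R :> 'Z_M)%R.
  rewrite /N /D !sqr_prime_to_prod // !natr_prod.
  (* Since [p ^ (2 * t)] divides [c * (c + b)], the element [e] is killed by [b], by [p ^ t] and by
     itself. *)
  pose e := (c * (c + b))%:R%R : 'Z_M.
  have q2e : p ^ t * p ^ t %| c * (c + b) by rewrite dvdn_mul // dvdn_add.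
  have eb0 : (e * b%:R = 0)%R by rewrite -natrM M_0 // def_M dvdn_mul.
  have ee0 : (e * e = 0)%R.
    by rewrite -natrM M_0 // def_M dvdn_mul // dvdn_mulr // dvdn_add.
  have eq0 : (e * (p ^ t)%:R = 0)%R by rewrite -natrM M_0 // def_M dvdn_mul.
  under eq_bigr do rewrite natrD.
  rewrite big_nat_cond [RHS]big_nat_cond.
  have Ux i : (0 <= i < b) && ~~ (p %| i) ->
      ((i * (b - i))%:R : 'Z_M)%R \is a GRing.unit.
    case/andP=> /andP[_ /ltnW i_le] pi.
    by rewrite natrM unitrM !Up // dvdn_subr.
  (* Because [e * b = 0], each [e / (i * (b - i))] equals [- e / i ^ 2], so the linear term is a sum
     of inverse squares. *)
  rewrite (prod_add_sqr0 _ ee0) // [X in (_ * (1 + X))%R](_ : _ = 0%R); last first.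
    case/dvdnP: (q_b) => w def_b.
    have := sum_inv_sqr_eq0 w p_pr p_gt3 t_gt0 Up eq0.
    rewrite (mulnC _ w) -def_b => /(congr1 -%R)%R; rewrite oppr0 -sumrN; apply: etrans.
    rewrite [RHS]big_nat_cond; apply: eq_bigr => i i_in.
    have Uxi := Ux i i_in.
    have Ui : (i%:R : 'Z_M)%R \is a GRing.unit by case/andP: i_in => _ /Up.
    case/andP: i_in => /andP[_ /ltnW i_le] _.
    apply: (mulIr Uxi); rewrite divrK // -mulNr mulrAC.
    apply: (mulIr (unitrX 2 Ui)); rewrite divrK ?unitrX //.
    rewrite natrM natrB //.
    have -> : (- e * (i%:R * (b%:R - i%:R)) = e * i%:R ^+ 2 - i%:R * (e * b%:R))%R by ring.
    by rewrite eb0 mulr0 subr0.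
  by rewrite addr0 mulr1; apply: eq_bigr => i _; rewrite mul0n addn0.
(* Modulo [p], [N + D] is [2 * D], which is prime to [p]; so [N + D] can be cancelled from
   [(N - D) * (N + D) = 0]. *)
have U_ND : ((N + D)%:R : 'Z_M)%R \is a GRing.unit.
  apply: M_unit; rewrite -coprime_modr -modnDml N_mod_p modnDml coprime_modr.
  rewrite addnn -muln2 coprimeMr coprime_prime_to_prod //.
  by rewrite prime_coprime // gtnNdvd // (ltn_trans _ p_gt3).
have : (N%:R = D%:R :> 'Z_M)%R.
  apply/eqP; rewrite -subr_eq0; apply/eqP; apply: (mulIr U_ND).
  by rewrite mul0r natrD -subr_sqr -!natrX eqND2 subrr.
by move/(congr1 (@nat_of_ord _)); rewrite !val_Zp_nat.
Qed.

(** * Divisibility and congruences of binomial coefficients *)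

(** From [k * 'C(n, k) = n * 'C(n.-1, k.-1)]: for [k > 0], the factor [k] absorbs at most [s] of the
    [s + e] powers of [p]. *)
Lemma dvdn_bin_pfactor (p s e n k : nat) : prime p ->
  p ^ (s + e) %| n -> ~~ (p ^ s.+1 %| k) -> p ^ e %| 'C(n, k).
Proof.
move=> p_pr q_n; case: k => [|k]; first by rewrite dvdn0.
rewrite pfactor_dvdn // -leqNgt => le_s.
case: (posnP 'C(n, k.+1)) => [->|C_gt0]; first by rewrite dvdn0.
have : p ^ (s + e) %| k.+1 * 'C(n, k.+1) by rewrite -mul_bin_diag dvdn_mulr.
by rewrite !pfactor_dvdn ?muln_gt0 // lognM //; lia.
Qed.

(** Used with [c = b] for the factor ['C(2 * k, k)]. *)
Lemma bin_mul_prime_mod (p t c b : nat) : prime p -> 3 < p -> 0 < t ->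
  p ^ t %| p * c -> p ^ t %| p * b ->
  'C(p * c + p * b, p * b) = 'C(c + b, b) %[mod p ^ (3 * t)].
Proof.
move=> p_pr p_gt3 t_gt0 q_c q_b.
apply: (@eqn_mod_coprime_cancel _ (prime_to_prod p 0 (p * b))).
  by rewrite coprimeXl // coprime_prime_to_prod.
rewrite mulnC bin_mul_prime ?prime_gt0 // mulnC -modnMml.
by rewrite (prime_to_prod_mod p_pr p_gt3 t_gt0 q_c q_b) modnMml.
Qed.

(** After multiplication by [D ^ A] the sides are [x ^ A * N ^ A] and [x ^ A * D ^ A]. As [x ^ A]
    supplies [p ^ (a * e)], it remains to compare [N] and [D] modulo [p ^ (a * t)]. *)
Lemma bin_exp_mul_prime_mod (p t e A a c b : nat) : prime p -> 3 < p -> 0 < t ->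
  p ^ t %| p * c -> p ^ t %| p * b -> p ^ e %| 'C(c + b, b) -> a <= 3 -> a <= A ->
  'C(p * c + p * b, p * b) ^ A = 'C(c + b, b) ^ A %[mod p ^ (a * (e + t))].
Proof.
move=> p_pr p_gt3 t_gt0 q_c q_b x_e a_le3 a_leA.
set X := 'C(_, _); set x := 'C(_, _).
have D_N := prime_to_prod_mod p_pr p_gt3 t_gt0 q_c q_b.
have X_x : X * _ = x * _ := bin_mul_prime c b (prime_gt0 p_pr).
set D := prime_to_prod p 0 _ in D_N X_x; set N := prime_to_prod p _ _ in D_N X_x.
apply: (@eqn_mod_coprime_cancel _ (D ^ A)).
  by rewrite coprimeXl // coprimeXr // coprime_prime_to_prod.
rewrite -!expnMn (mulnC D X) X_x (mulnC D x) !expnMn.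
have /dvdnP[y ->] : p ^ (a * e) %| x ^ A.
  by rewrite mulnC expnM (dvdn_trans (dvdn_exp2l _ a_leA)) // dvdn_exp2r.
rewrite mulnDr expnD -!mulnA !(mulnCA y).
rewrite -!muln_modr; congr (_ * _); rewrite -modnMmr -[RHS]modnMmr.
congr ((_ * _) %% _); rewrite -modnXm -[RHS]modnXm; congr (_ ^ _ %% _).
have q3 : p ^ (a * t) %| p ^ (3 * t) by rewrite dvdn_exp2l // leq_mul2r a_le3 orbT.
by rewrite -(modn_dvdm _ q3) D_N modn_dvdm.
Qed.

(** * Comparison of the sums term by term *)

(** The parameter [a] handles both moduli at once: 3 when [A >= 3], and 2 when [A = 2]. *)
Lemma Csum_mod (A B p m r a : nat) : prime p -> 3 < p -> a <= 3 -> a <= A ->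
  Csum (m * p ^ r.+1) A B = Csum (m * p ^ r) A B %[mod p ^ (a * r.+1)].
Proof.
move=> p_pr p_gt3 a_le3 a_leA; have p_gt0 := prime_gt0 p_pr.
set n := m * p ^ r; have -> : m * p ^ r.+1 = p * n by rewrite expnS mulnCA.
set M := p ^ _.
pose F N k := 'C(N, k) ^ A * 'C(2 * k, k) ^ B.
have F_ndvd k : ~~ (p %| k) -> M %| F (p * n) k.
  move=> pk; rewrite dvdn_mulr // /M (mulnC a) expnM.
  apply: (dvdn_trans (dvdn_exp2l _ a_leA)); rewrite dvdn_exp2r //.
  apply: (@dvdn_bin_pfactor p 0) => //.
  by rewrite add0n expnS dvdn_mul // dvdn_mull.
have F_mul j : j <= n -> F (p * n) (p * j) = F n j %[mod M].
  move=> j_le; pose c := n - j.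
  (* If [p ^ r] divides [j] (in particular if [j = 0]), [e = 0] suffices; otherwise [t] is the
     valuation of [p * j], and ['C(n, j)] supplies the missing [e]. *)
  have [t [e [te t_gt0 q_j x_e]]] : exists t e,
      [/\ e + t = r.+1, 0 < t, p ^ t %| p * j & p ^ e %| 'C(n, j)].
    case: (boolP (p ^ r.+1 %| p * j)) => [q_j|]; first by exists r.+1, 0.
    rewrite expnS dvdn_pmul2l // => q_j.
    have j_gt0 : 0 < j by case: j q_j {j_le c} => //; rewrite dvdn0.
    move: (q_j); rewrite pfactor_dvdn // -ltnNge => s_lt.
    exists (logn p j).+1, (r - logn p j); split=> //.
    - by rewrite addnS subnK // ltnW.
    - by rewrite expnS dvdn_pmul2l // pfactor_dvdnn.
    - apply: (@dvdn_bin_pfactor p (logn p j)) => //.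
        by rewrite subnKC ?(ltnW s_lt) // dvdn_mull.
      by rewrite pfactor_dvdn // ltnn.
  have q_c : p ^ t %| p * c.
    by rewrite mulnBr dvdn_sub // (dvdn_trans (dvdn_exp2l _ (_ : t <= r.+1)))
      ?expnS ?dvdn_mul ?dvdn_mull // -te leq_addl.
  have C_n := bin_exp_mul_prime_mod p_pr p_gt3 t_gt0 q_c q_j.
  rewrite -mulnDr subnK // in C_n.
  rewrite /F /M -te -modnMml (C_n _ _ _ x_e a_le3 a_leA) modnMml.
  (* The same factor [p ^ (a * e)] reduces the comparison of the central binomials to modulus
     [p ^ (a * t)]. *)
  have /dvdnP[y ->] : p ^ (a * e) %| 'C(n, j) ^ A.
    by rewrite mulnC expnM (dvdn_trans (dvdn_exp2l _ a_leA)) // dvdn_exp2r.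
  have q3 : p ^ (a * t) %| p ^ (3 * t) by rewrite dvdn_exp2l // leq_mul2r a_le3 orbT.
  have := bin_mul_prime_mod p_pr p_gt3 t_gt0 q_j q_j.
  rewrite -mulnDr addnn -mul2n mulnCA => D_j.
  rewrite mulnDr expnD !(mulnC y) -!(mulnA _ y) -!muln_modr.
  congr (_ * _); rewrite -modnMmr -[RHS]modnMmr; congr (_ * _ %% _).
  rewrite -modnXm -[RHS]modnXm; congr (_ ^ _ %% _).
  by rewrite -(modn_dvdm _ q3) D_j modn_dvdm.
have Csum_F N : Csum N A B = \sum_(0 <= k < N.+1) F N k by rewrite big_mkord.
(* The top terms [k = p * n] and [k = n] are split off and matched with each other, leaving the
   half-open ranges that [big_nat_dvdn] relates. *)
clearbody F M; rewrite !Csum_F !big_nat_recr //=.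
rewrite (bigID (fun k => p %| k)) /= big_nat_dvdn //.
have /dvdnP[y ->] : M %| \sum_(0 <= k < p * n | ~~ (p %| k)) F (p * n) k.
  by apply: dvdn_sum => k; exact: F_ndvd.
rewrite (addnC _ (y * M)) -addnA modnMDl -modnDm (F_mul n) // -[RHS]modnDm.
congr ((_ + _) %% _).
rewrite -(modn_summ _ _ (fun j => F (p * n) (p * j))) -(modn_summ _ _ (F n)).
congr (_ %% _); apply: eq_big_nat => j /andP[_ /ltnW j_le]; exact: F_mul.
Qed.

Theorem theorem1p1 (A B p m r : nat) (hA : 0 < A) (hB : 0 < B)
    (p_prime : prime p) (p_gt3 : 3 < p) (hm : 0 < m) (hr : 0 < r) :
  (3 <= A ->
     Csum (m * p ^ r) A B = Csum (m * p ^ (r - 1)) A B %[mod p ^ (3 * r)]) /\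
  Csum (m * p ^ r) 2 B = Csum (m * p ^ (r - 1)) 2 B %[mod p ^ (2 * r)].
Proof.
case: r hr => // r _; rewrite subSS subn0.
by split=> [A_ge3|]; exact: Csum_mod.
Qed.
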